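(* Let $f:\mathbb{R}\to\mathbb{R}$ be a Lebesgue measurable function. Assume that there exists $L>0$ such that $|f(x)-f(y)|\geq L|x-y|$ for all $x,y\in\mathbb{R}$. Then $f$ is $(S,S)$-measurable.
   Context: $S$ denotes the sigma-algebra of Lebesgue measurable subsets of $\mathbb{R}$. A function $f:\mathbb{R}\to\mathbb{R}$ is Lebesgue measurable if $f^{-1}(B)\in S$ for every Borel set $B\subset\mathbb{R}$; it is $(S,S)$-measurable if $f^{-1}(A)\in S$ for every $A\in S$. *)

(* Defs.v *)
From mathcomp Require Import all_boot all_order all_algebra.
From mathcomp Require Import all_classical all_reals all_analysis.

Set Implicit Arguments.
Unset Strict Implicit.
Unset Printing Implicit Defensive.

Import Order.TTheory GRing.Theory Num.Theory.
Import numFieldNormedType.Exports.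

Local Open Scope classical_set_scope.
Local Open Scope ring_scope.

(* The real line with the sigma-algebra S of Lebesgue measurable sets, i.e. the
   Caratheodory sets of the outer measure induced by interval length.  This is
   the domain of [completed_lebesgue_measure]; in contrast, [measurableTypeR R]
   is the real line with its Borel sigma-algebra. *)
Definition lebesgueTypeR (R : realType) : Type :=
  caratheodory_type ((@wlength R idfun)^*)%mu.

Definition lebesgue_measurable_fun (R : realType) (f : R -> R) : Prop :=
  measurable_fun [set: lebesgueTypeR R]
    (f : lebesgueTypeR R -> measurableTypeR R).

Definition SS_measurable_fun (R : realType) (f : R -> R) : Prop :=
  measurable_fun [set: lebesgueTypeR R]
    (f : lebesgueTypeR R -> lebesgueTypeR R).

(* Main.v *)
Require Import Defs.
From mathcomp Require Import all_boot all_order all_algebra.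
From mathcomp Require Import all_classical all_reals all_analysis.
From mathcomp Require Import lra.
Import Order.TTheory GRing.Theory Num.Theory.
Local Open Scope ring_scope.

(** The hypothesis says that [f] is injective with an inverse, defined on the
    range of [f], that is Lipschitz with constant [L^-1].  Measurability of [f]
    only concerns preimages of Borel sets, but a Lebesgue measurable
    set is the union of a Borel set and a subset of a Borel null set
    ([completed_caratheodory_measurable]), so only preimages of null sets
    remain.  These are null because a Lipschitz map multiplies outer measure by
    at most its constant ([outer_measure_preimage_expanding]): the preimage of
    an interval of length [d] has diameter at most [d / L], hence outer measure
    at most [d / L], and this sums over any countable cover by intervals.
    Finally, sets of outer measure zero are Caratheodory measurable. *)

Local Open Scope classical_set_scope.

Local Notation lambda_star := ((@wlength _ idfun)^*)%mu.

(** A nonempty such set lies in the closed interval of length [d] that starts at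
    its infimum. *)
Lemma outer_measure_le_diameter (R : realType) (E : set R) (d : R) :
  0 <= d -> (forall x y, E x -> E y -> `|x - y| <= d) ->
  (lambda_star E <= d%:E)%E.
Proof.
move=> d0 Ed.
have [->|/set0P[x0 Ex0]] := eqVneq E set0; first by rewrite outer_measure0.
have lbE x : E x -> lbound E (x - d).
  move=> Ex y Ey; rewrite lerBlDr -lerBlDl.
  exact: le_trans (ler_norm _) (Ed _ _ Ex Ey).
have infE x : E x -> inf E <= x.
  by move=> Ex; apply: ge_inf => //; exists (x0 - d); exact: lbE.
have supE x : E x -> x <= inf E + d.
  move=> Ex; rewrite -lerBlDr; apply: lb_le_inf; first by exists x0.
  exact: lbE.
have EI : E `<=` `[inf E, inf E + d]%classic.
  by move=> x Ex /=; rewrite in_itv/= infE//= supE.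
apply: (le_trans (le_outer_measure lambda_star _ _ EI)).
rewrite [leLHS](_ : _ = @lebesgue_measure R `[inf E, inf E + d]%classic)//.
rewrite lebesgue_measure_itv/= lte_fin; case: ifPn => _; last by rewrite lee_fin.
by rewrite -EFinD lee_fin addrAC subrr add0r.
Qed.

(** The inverse of [f] is Lipschitz on the range of [f]: each interval of
    a cover of [A] pulls back to a set whose diameter is at most [L^-1] times the length of
    the interval, and these sets cover the preimage of [A]. *)
Lemma outer_measure_preimage_expanding (R : realType) (f : R -> R) (L : R)
    (A : set R) :
  0 < L -> (forall x y, L * `|x - y| <= `|f x - f y|) ->
  (lambda_star (f @^-1` A) <= L^-1%:E * lambda_star A)%E.
Proof.
move=> L0 fL.
have L1 : 0 < L^-1 by rewrite invr_gt0.
(* Moving the constant to the left lets the infimum defining the outer measure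
   of [A] be bounded cover by cover. *)
rewrite lee_pdivlMl//.
apply: le_ereal_inf_tmp => _ [I [mI AI] <-].
rewrite -lee_pdivlMl// -nneseriesZl; last by move=> k _; exact: wlength_ge0.
apply: (@le_trans _ _ (lambda_star (\bigcup_k (f @^-1` I k)))).
  by apply: le_outer_measure; rewrite -preimage_bigcup; exact: preimage_subset.
apply: (le_trans (outer_measure_sigma_subadditive _ _)).
apply: lee_nneseries => // k _.
have [[a b] _ <-] := mI k.
rewrite wlength_itv/= lte_fin; case: ifPn => [ab|].
  rewrite -EFinD -EFinM; apply: outer_measure_le_diameter.
    by rewrite mulr_ge0 ?ltW// subr_gt0.
  move=> x y /=; rewrite !in_itv/= => /andP[ax xb] /andP[ay yb].
  rewrite ler_pdivlMl//; apply: (le_trans (fL x y)).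
  by rewrite ler_norml; apply/andP; split; lra.
rewrite -leNgt => ba.
rewrite mule0 set_itv_ge ?bnd_simp -?leNgt//.
by rewrite preimage_set0 outer_measure0.
Qed.

Theorem theorem4p1 (R : realType) (f : R -> R)
  (mf : lebesgue_measurable_fun f)
  (hf : exists L : R, 0 < L /\
    forall x y : R, L * `|x - y| <= `|f x - f y|) :
  SS_measurable_fun f.
Proof.
have [L [L0 fL]] := hf.
move=> mT A mA; rewrite setTI.
have [B mB [N /negligible_outer_measure N0 <-]] :
    measurable_realfun.completed_algebra_gen (@lebesgue_measure R) A.
  by rewrite -g_sigma_completed_algebra_genE completed_caratheodory_measurable.
rewrite preimage_setU; apply: measurableU.
  by rewrite -[_ @^-1` _]setTI; exact: mf.
apply: completed_lebesgue_measure_is_complete.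
have fN0 : lambda_star (f @^-1` N) = 0%E.
  apply/eqP; rewrite eq_le outer_measure_ge0 andbT.
  apply: (le_trans (@outer_measure_preimage_expanding R f L N L0 fL)).
  by rewrite N0 mule0.
have /negligible_outer_measure[C [mC C0 NC]] := fN0.
by exists C; split => //; exact: sub_caratheodory.
Qed.
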